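(* Let $k\geq 2$ and let $G$ be a $k$-connected but not $(k+1)$-connected graph with $n$ vertices and $m$ edges. Then $mc(G)=m-n+k+1$ if and only if either $G\in\mathcal{A}_{n,k}$ or $G$ is a $k$-perfectly-connected graph.
   Context: All graphs are simple, finite and undirected. A complete graph $K_{p}$ is regarded as $(p-1)$-connected but not $p$-connected. An edge-coloring of a connected graph $G$ (an arbitrary assignment of colors to edges) is a monochromatic connection coloring (MC-coloring) if any two vertices of $G$ are connected by a path all of whose edges have the same color. The monochromatic connection number $mc(G)$ is the maximum number of colors used in an MC-coloring of $G$. $G\vee H$ denotes the join of vertex-disjoint graphs $G$ and $H$ (add all edges between $V(G)$ and $V(H)$). $\mathcal{A}_{n,k}$ is the set of graphs $K_{k-1}\vee H$, where $H$ is a connected graph with $|V(H)|=n-k+1$ and $H$ has a cut-vertex. Pairwise disjoint vertex sets $U_1,\dots,U_s$ of $G$ ''form a complete $s$-partite graph'' if every vertex of $U_i$ is adjacent in $G$ to every vertex of $U_j$ for all $i\neq j$ (edges inside the $U_i$ are allowed). A graph is $s$-perfectly-connected if its vertex set can be partitioned into $s+1$ parts $\{v\},V_1,\dots,V_s$ such that each $V_i$ induces a connected subgraph, $V_1,\dots,V_s$ form a complete $s$-partite graph, and $v$ has precisely one neighbor in each $V_i$. *)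

(* Defs.v *)
From mathcomp Require Import all_boot.

Set Implicit Arguments.
Unset Strict Implicit.
Unset Printing Implicit Defensive.

Record sgraph := SGraph {
  vertex :> finType;
  adj : rel vertex;
  adj_sym : symmetric adj;
  adj_irrefl : irreflexive adj }.

Definition edges (G : sgraph) : {set {set G}} :=
  [set [set p.1; p.2] | p : G * G & adj p.1 p.2].

(* Vacuously true for the empty set, so that the vertex of a one-vertex graph
   is not a cut-vertex. *)
Definition connected_in (G : sgraph) (A : {set G}) : bool :=
  [forall x in A, forall y in A,
    connect [rel a b | [&& a \in A, b \in A & adj a b]] x y].

Definition connected (G : sgraph) : bool := connected_in [set: G].

Definition cut_vertex (G : sgraph) (v : G) : bool :=
  connected G && ~~ connected_in (~: [set v]).

(* The bound on #|G| makes K_p (p-1)-connected but not p-connected. *)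
Definition kconnected (k : nat) (G : sgraph) : bool :=
  (k < #|G|) && [forall S : {set G}, (#|S| < k) ==> connected_in (~: S)].

(* Colorings are total functions on {set G}; only the values on edges G
   matter. *)
Definition mc_coloring (G : sgraph) (C : eqType) (c : {set G} -> C) : bool :=
  [forall u, forall v, (u != v) ==>
    [exists f in edges G,
      connect [rel x y | adj x y && (c [set x; y] == c f)] u v]].

Definition ncolors (G : sgraph) (C : eqType) (c : {set G} -> C) : nat :=
  size (undup [seq c f | f in edges G]).

(* A palette of #|edges G| colors loses no generality: see mc_max and
   mc_attained. *)
Definition mc (G : sgraph) : nat :=
  \max_(c : {ffun {set G} -> 'I_#|edges G|} | mc_coloring c) ncolors c.

Definition isomorphic (G H : sgraph) : Prop :=
  exists2 f : G -> H, bijective f & forall x y, adj (f x) (f y) = adj x y.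

Definition complete_adj (p : nat) : rel 'I_p := fun x y => x != y.

Fact complete_adj_sym p : symmetric (@complete_adj p).
Proof. by move=> x y; rewrite /complete_adj eq_sym. Qed.

Fact complete_adj_irrefl p : irreflexive (@complete_adj p).
Proof. by move=> x; rewrite /complete_adj eqxx. Qed.

Definition complete (p : nat) : sgraph :=
  SGraph (@complete_adj_sym p) (@complete_adj_irrefl p).

Definition join_adj (G H : sgraph) : rel (G + H) := fun x y =>
  match x, y with
  | inl a, inl b => adj a b
  | inr a, inr b => adj a b
  | _, _ => true
  end.

Fact join_adj_sym G H : symmetric (@join_adj G H).
Proof. by move=> [x|x] [y|y] //=; rewrite adj_sym. Qed.

Fact join_adj_irrefl G H : irreflexive (@join_adj G H).
Proof. by move=> [x|x] /=; rewrite adj_irrefl. Qed.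

Definition join (G H : sgraph) : sgraph :=
  SGraph (@join_adj_sym G H) (@join_adj_irrefl G H).

Definition in_A (n k : nat) (G : sgraph) : Prop :=
  exists H : sgraph,
    [/\ connected H, #|H| = n - k + 1, exists v : H, cut_vertex v
      & isomorphic G (join (complete (k - 1)) H)].

Definition complete_multipartite (G : sgraph) (s : nat) (V : 'I_s -> {set G})
  : Prop :=
  forall i j, i != j -> forall x y, x \in V i -> y \in V j -> adj x y.

Definition perfectly_connected (s : nat) (G : sgraph) : Prop :=
  exists (v : G) (V : 'I_s -> {set G}),
    [/\ (forall i, V i != set0) /\ (forall i j, i != j -> [disjoint V i & V j]),
        \bigcup_i V i = ~: [set v],
        forall i, connected_in (V i),
        complete_multipartite V
      & forall i, #|[set u in V i | adj v u]| = 1].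

Section McSpec.

Variable G : sgraph.

Lemma edgeP x y : adj x y -> [set x; y] \in edges G.
Proof. by move=> xy; apply/imsetP; exists (x, y); rewrite ?inE. Qed.

Lemma mc_recolor (C D : eqType) (c : {set G} -> C) (d : {set G} -> D) :
    {in edges G &, forall f g, (c f == c g) = (d f == d g)} ->
  mc_coloring c -> mc_coloring d.
Proof.
move=> cd /forallP h; apply/forallP => u; apply/forallP => v.
apply/implyP => uv.
have /existsP[f /andP[fE cuv]] := implyP (forallP (h u) v) uv.
apply/existsP; exists f; rewrite fE /= in cuv *.
rewrite (eq_connect (e' := [rel x y | adj x y && (c [set x; y] == c f)])) //.
by move=> x y /=; case: (boolP (adj x y)) => //= xy; rewrite cd // edgeP.
Qed.

Lemma ncolors_recolor (C D : eqType) (c : {set G} -> C) (d : {set G} -> D) :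
    {in edges G &, forall f g, (c f == c g) = (d f == d g)} ->
  ncolors c = ncolors d.
Proof.
rewrite /ncolors /image_mem => cd.
have : {subset enum (edges G) <= edges G} by move=> f; rewrite mem_enum.
elim: (enum _) => //= f s IHs sE.
have fE : f \in edges G by apply: sE; rewrite mem_head.
have {}sE : {subset s <= edges G} by move=> g gs; apply: sE; rewrite inE gs orbT.
have -> : (c f \in map c s) = (d f \in map d s).
  apply/mapP/mapP => -[g gs /eqP]; rewrite ?cd ?fE ?sE // => /eqP e; exists g => //.
  by apply/eqP; rewrite cd ?fE ?sE // e.
by case: ifP => _ /=; rewrite IHs.
Qed.

Lemma mc_max (C : eqType) (c : {set G} -> C) :
  mc_coloring c -> ncolors c <= mc G.
Proof.
move=> cM; pose s := undup [seq c f | f in edges G].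
have [E0|E0] := posnP #|edges G|.
  rewrite /ncolors (leq_trans (size_undup _)) // size_map -cardE E0 //.
have sE : size s <= #|edges G|.
  by rewrite (leq_trans (size_undup _)) // size_map -cardE.
have cs f : f \in edges G -> c f \in s.
  by move=> fE; rewrite mem_undup; apply: map_f; rewrite mem_enum.
pose d0 f := index (c f) s.
have d0lt f : f \in edges G -> d0 f < #|edges G|.
  by move=> fE; rewrite (leq_trans _ sE) // index_mem cs.
pose d := [ffun f => insubd (Ordinal E0) (d0 f)].
have dE f : f \in edges G -> d f = d0 f :> nat.
  by move=> fE; rewrite ffunE val_insubd d0lt.
have cd : {in edges G &, forall f g, (c f == c g) = (d f == d g)}.
  move=> f g fE gE; rewrite -[RHS]val_eqE /= !dE //.
  apply/eqP/eqP => [|ei]; first by rewrite /d0 => ->.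
  by rewrite -(nth_index (c f) (cs f fE)) -/(d0 f) ei /d0 nth_index // cs.
rewrite (ncolors_recolor cd).
apply: (leq_bigmax_cond (F := fun c : {ffun {set G} -> 'I__} => ncolors c)).
exact: mc_recolor cM.
Qed.

Lemma mc_attained : connected G ->
  exists2 c : {set G} -> nat, mc_coloring c & ncolors c = mc G.
Proof.
move=> Gc; pose c0 (f : {set G}) := 0.
have c0M : mc_coloring c0.
  apply/forallP => u; apply/forallP => v; apply/implyP => uv.
  have cuv : connect (@adj G) u v.
    have /forall_inP/(_ u (in_setT u))/forall_inP/(_ v (in_setT v)) := Gc.
    by apply: connect_sub => x y /= /and3P[_ _ xy]; apply: connect1.
  have /connectP[[|w p] /= + vE] := cuv; first by rewrite vE eqxx in uv.
  move=> /andP[uw _]; apply/existsP; exists [set u; w]; rewrite edgeP //=.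
  by apply: connect_sub cuv => x y xy; apply: connect1; rewrite /= xy eqxx.
have [E0|E0] := posnP #|edges G|.
  exists c0 => //; apply/eqP; rewrite eqn_leq mc_max //=.
  apply/bigmax_leqP => c _; rewrite /ncolors (leq_trans (size_undup _)) //.
  by rewrite size_map -cardE E0.
pose d0 : {ffun {set G} -> 'I_#|edges G|} := [ffun=> Ordinal E0].
have d0M : mc_coloring d0.
  by apply: mc_recolor c0M => f g _ _; rewrite !ffunE !eqxx.
have /(eq_bigmax_cond (fun c => ncolors (fun_of_fin c)))[d dM mcE] :
    0 < #|[pred c : {ffun {set G} -> 'I_#|edges G|} | mc_coloring c]|.
  by apply/card_gt0P; exists d0.
have de : {in edges G &, forall f g, (d f == d g) = (d f == d g :> nat)} by [].
exists (fun f => d f : nat); first exact: mc_recolor dM.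
by rewrite -(ncolors_recolor de) -mcE.
Qed.

End McSpec.

(* Main.v *)
(** Proof idea. The colour classes of an optimal colouring partition the edges
    into [mc G] sets [F], and [\sum_F (#|F| - 1) = m - mc G]. Let [S] be a cut
    of size [k] separating [A] from [B]. Fix [a] in [A] and [b] in [B]. A
    connected piece of [F] meeting both sides also meets [S], which gives
    [#|F| - 1 >= p + q], where [p] counts the vertices of [B] that [F] joins to
    [a] and [q] those of [A] other than [a] that [F] joins to [b]. Every
    vertex of [B] is joined to [a], and every vertex of [A] to [b], by some
    [F]; summing, [m - mc G >= #|A| + #|B| - 1 = n - k - 1]. In the extremal
    case this is an equality for every [F] and every choice of [a] and [b]. If
    both sides have at least two vertices, a single nontrivial [F] remains; it
    spans [A], [B] and one vertex of [S], so the rest of [S] is universal. If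
    [B = [set b]], the nontrivial classes are trees that meet pairwise only in
    [b], and with the remaining vertices of [S] they give the parts of a
    perfectly connected graph. *)
Require Import Defs.
From mathcomp Require Import all_boot all_order all_algebra zify.
Import GRing.Theory.

Set Implicit Arguments.
Unset Strict Implicit.
Unset Printing Implicit Defensive.

(** * Paths leaving a set, and tight double counting *)

Lemma connect_cross (T : finType) (e : rel T) (R : {set T}) x y :
  connect e x y -> x \in R -> y \notin R ->
  exists u v, [/\ u \in R, v \notin R & e u v].
Proof.
move=> /connectP[p + ->] {y}; elim: p x => [|z p IHp] x /=.
  by move=> _ ->.
move=> /andP[xz zp] xR zpR; have [zR|zR] := boolP (z \in R).
  exact: IHp zp zR zpR.
by exists x, z.
Qed.

Lemma connect_first (T : finType) (e : rel T) x y :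
  connect e x y -> x != y -> exists z, e x z.
Proof.
move=> exy xy.
have [||u [v [/set1P-> _ xv]]] := connect_cross (R := [set x]) exy.
- exact: set11.
- by rewrite inE eq_sym.
by exists v.
Qed.

Lemma connect_homo (T U : finType) (e : rel T) (e' : rel U) (h : T -> U) :
  (forall x y, e x y -> e' (h x) (h y)) ->
  forall x y, connect e x y -> connect e' (h x) (h y).
Proof.
move=> he x y /connectP[p + ->] {y}; elim: p x => //= z p IHp x /andP[xz zp].
exact: connect_trans (connect1 (he _ _ xz)) (IHp _ zp).
Qed.

Lemma sum_leq_eq (I : finType) (P : {set I}) (f g : I -> nat) :
  {in P, forall i, f i <= g i} -> \sum_(i in P) g i <= \sum_(i in P) f i ->
  {in P, forall i, f i = g i}.
Proof.
move=> fg gf i iP; apply/eqP; rewrite eqn_leq fg //=.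
rewrite (bigD1 i iP) /= [X in _ <= X](bigD1 i iP) /= in gf.
have : \sum_(j in P | j != i) f j <= \sum_(j in P | j != i) g j.
  by apply: leq_sum => j /andP[jP _]; apply: fg.
by move=> /(leq_add (leqnn (f i)))/(leq_trans gf); rewrite leq_add2r.
Qed.

Lemma sum_card_exchange (I T : finType) (P : {set I}) (Q : I -> {set T})
    (A : {set T}) :
  {in P, forall i, Q i \subset A} ->
  \sum_(i in P) #|Q i| = \sum_(x in A) #|[set i in P | x \in Q i]|.
Proof.
move=> QA; under eq_bigr do rewrite -sum1_card.
under [RHS]eq_bigr do rewrite -sum1_card.
rewrite (exchange_big_dep (mem A)) /= => [|i x iP xQ]; last first.
  exact: subsetP (QA i iP) x xQ.
by apply: eq_bigr => x xA; apply: eq_bigl => i; rewrite inE.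
Qed.

Lemma cover_leq_sum (I T : finType) (P : {set I}) (Q : I -> {set T})
    (A : {set T}) :
  {in P, forall i, Q i \subset A} ->
  {in A, forall x, exists2 i, i \in P & x \in Q i} ->
  #|A| <= \sum_(i in P) #|Q i|.
Proof.
move=> QA AQ; rewrite (sum_card_exchange QA) -sum1_card; apply: leq_sum => x xA.
by have [i iP xi] := AQ x xA; rewrite card_gt0; apply/set0Pn; exists i; rewrite inE iP.
Qed.

(** By double counting, the sum adds up how often each point of [A] is covered. Each multiplicity is
    at least one, so a total of at most [#|A|] forces every one of them to be exactly one. *)
Lemma cover_eq_sum (I T : finType) (P : {set I}) (Q : I -> {set T})
    (A : {set T}) :
  {in P, forall i, Q i \subset A} ->
  {in A, forall x, exists2 i, i \in P & x \in Q i} ->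
  \sum_(i in P) #|Q i| <= #|A| ->
  {in P &, forall i j x, x \in Q i -> x \in Q j -> i = j}.
Proof.
move=> QA AQ; rewrite (sum_card_exchange QA) -sum1_card => le i j iP jP x xi xj.
have xA : x \in A by apply: subsetP (QA i iP) _ xi.
have cov y : y \in A -> 1 <= #|[set i in P | y \in Q i]|.
  move=> yA; have [l lP yl] := AQ y yA.
  by rewrite card_gt0; apply/set0Pn; exists l; rewrite inE lP.
have /esym/eqP/cards1P[l E] := sum_leq_eq cov le xA.
have : i \in [set l] by rewrite -E inE iP.
have : j \in [set l] by rewrite -E inE jP.
by move=> /set1P-> /set1P->.
Qed.

(** * Sets of edges as relations, and spanning trees *)

Definition erel (G : sgraph) (F : {set {set G}}) : rel G :=
  [rel x y | [set x; y] \in F].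

Lemma con_sym (G : sgraph) (F : {set {set G}}) : connect_sym (erel F).
Proof. by apply: sym_connect_sym => x y; rewrite /erel /= setUC. Qed.

Lemma edges_adj (G : sgraph) (x y : G) : ([set x; y] \in edges G) = adj x y.
Proof.
apply/idP/idP => [/imsetP[[u v]]|]; last exact: edgeP.
rewrite inE /= => uv E.
have : x \in [set u; v] by rewrite -E set21.
have : y \in [set u; v] by rewrite -E set22.
have : u \in [set x; y] by rewrite E set21.
have : v \in [set x; y] by rewrite E set22.
rewrite !inE; do 4!case/orP => /eqP ?; subst => //.
all: by rewrite ?adj_irrefl in uv *; rewrite // adj_sym.
Qed.

(* Growing [R] one reachable vertex at a time uses up a new edge of [F] each
   time. *)
Lemma reach_card (G : sgraph) (F : {set {set G}}) (R X : {set G}) :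
  {in X, forall x, exists2 r, r \in R & connect (erel F) r x} ->
  [disjoint X & R] -> #|X| <= #|F|.
Proof.
(* Only edges not contained in [R] are counted: the edge leaving [R] towards a new vertex [z] drops
   out of the count once [z] joins [R]. *)
move=> XR dXR; apply: (@leq_trans #|[set f in F | ~~ (f \subset R)]|); last first.
  by rewrite subset_leq_card //; apply/subsetP => f; rewrite inE => /andP[].
have -> : X = X :\: R by apply/esym/setDidPl.
move=> {dXR}; have [N] := ubnP #|~: R|; elim: N R XR => // N IHN R XR RN.
have [/eqP->|/set0Pn[x]] := boolP (X :\: R == set0); first by rewrite cards0.
rewrite inE => /andP[xR xX]; have [r rR rx] := XR x xX.
have [y [z [yR zR yz]]] := connect_cross rx rR xR.
have {}yz : [set y; z] \in F := yz.
have {}IHN : #|X :\: (z |: R)| <= #|[set f in F | ~~ (f \subset z |: R)]|.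
  apply: IHN => [u /XR[w wR wu]|].
    by exists w => //; rewrite inE wR orbT.
  have -> : ~: (z |: R) = (~: R) :\ z by apply/setP => u; rewrite !inE negb_or.
  by move: RN; rewrite (cardsD1 z (~: R)) inE zR.
have XD : #|X :\: R| <= #|X :\: (z |: R)|.+1.
  have -> : X :\: (z |: R) = (X :\: R) :\ z by apply/setP => u; rewrite !inE negb_or andbA.
  by rewrite (cardsD1 z (X :\: R)); case: (_ \in _).
apply: leq_trans XD _; apply: leq_ltn_trans IHN _; apply: proper_card.
apply/properP; split.
  apply/subsetP => f; rewrite !inE => /andP[-> /=].
  by apply: contra => /subset_trans; apply; apply: subsetUr.
exists [set y; z].
  by rewrite inE yz subUset !sub1set (negbTE zR) andbF.
by rewrite inE yz subUset !sub1set !inE eqxx yR orbT.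
Qed.

(** Connecting [U] with fewer than [#|U|] edges is what makes [F] a spanning tree. It is grown from
    a root [r], one vertex and one edge at a time. *)
Lemma spanning_tree (G : sgraph) (U : {set G}) : U != set0 -> connected_in U ->
  exists F : {set {set G}}, [/\ F \subset edges G, {in F, forall f : {set G}, f \subset U},
    #|F| < #|U| & {in U &, forall x y, connect (erel F) x y}].
Proof.
move=> /set0Pn[r rU] Uc.
have Ur x : x \in U -> connect [rel a b | [&& a \in U, b \in U & adj a b]] r x.
  by move=> xU; have /forall_inP/(_ r rU)/forall_inP/(_ x xU) := Uc.
suff /(_ #|U|.-1)[|R [F [RU rR Rn [FE FR Fn Fc]]]] : forall n, n < #|U| ->
    exists (R : {set G}) (F : {set {set G}}),
    [/\ R \subset U, r \in R, #|R| = n.+1 &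
    [/\ F \subset edges G, {in F, forall f : {set G}, f \subset R},
    #|F| <= n & {in R, forall x, connect (erel F) r x}]].
- by rewrite prednK //; apply/card_gt0P; exists r.
- have U0 : 0 < #|U| by apply/card_gt0P; exists r.
  have RE : R = U by apply/eqP; rewrite eqEcard RU /=; lia.
  exists F; rewrite -{}RE in Fn *; split=> //; first by lia.
  move=> x y xR yR; apply: connect_trans (Fc y yR).
  by rewrite con_sym; apply: Fc.
elim=> [|n IHn] nU.
  exists [set r], set0; rewrite sub1set rU set11 cards1 cards0 sub0set; split=> //.
  by split=> // [f|x /set1P->]; rewrite ?inE.
have [R [F [RU rR Rn [FE FR Fn Fc]]]] := IHn (ltnW nU).
have /subsetPn[x xU xR] : ~~ (U \subset R).
  by apply/negP => /subset_leq_card; lia.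
have [y [z [yR zR /and3P[yU zU yz]]]] := connect_cross (Ur x xU) rR xR.
exists (z |: R), ([set y; z] |: F); split.
- by rewrite subUset sub1set zU.
- by rewrite inE rR orbT.
- by rewrite cardsU1 zR Rn.
split.
- by rewrite subUset sub1set edges_adj yz.
- move=> f /setU1P[->|/FR fR].
    by rewrite subUset !sub1set !inE eqxx yR orbT.
  by rewrite subsetU // fR orbT.
- by rewrite cardsU1; case: (_ \notin _); lia.
have Fs u v : connect (erel F) u v -> connect (erel ([set y; z] |: F)) u v.
  by apply: (connect_homo (h := id)) => a b; rewrite /erel /= inE => ->; rewrite orbT.
move=> u /setU1P[->|/Fc/Fs//]; apply: connect_trans (Fs _ _ (Fc y yR)) (connect1 _).
by rewrite /erel /= setU11.
Qed.

(** * Colorings built from families of sets, and the classes of an optimal coloring *)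

Lemma ncolors_card (G : sgraph) (C : finType) (c : {set G} -> C) :
  ncolors c = #|[set c f | f in edges G]|.
Proof.
rewrite /ncolors -(card_uniqP (undup_uniq _)); apply: eq_card => x.
by rewrite mem_undup; apply/imageP/imsetP.
Qed.

(** A spanning tree of each [W i] receives one color, and every remaining edge a color of its own.
    The tree of [W i] has at most [#|W i| - 1] edges and one color, which gives the count. *)
Lemma mc_lower (G : sgraph) (I : finType) (W : I -> {set G}) :
    (forall i, connected_in (W i)) -> (forall i, 1 < #|W i|) ->
    (forall i j, i != j -> #|W i :&: W j| <= 1) ->
    (forall x y, x != y -> ~~ adj x y -> exists i, (x \in W i) && (y \in W i)) ->
  #|edges G| + #|I| * 2 <= mc G + \sum_i #|W i|.
Proof.
move=> Wc W1 WI Wn.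
have /fin_all_exists[F FP] : forall i, exists F : {set {set G}},
    [/\ F \subset edges G, {in F, forall f : {set G}, f \subset W i},
    #|F| < #|W i| & {in W i &, forall x y, connect (erel F) x y}].
  by move=> i; apply: spanning_tree (Wc i); rewrite -card_gt0 ltnW.
(* No tree is empty, so the color of each index really occurs. *)
have F0 i : exists f, f \in F i.
  have [_ _ _ Fc] := FP i; have /card_gt1P[x [y [xW yW xy]]] := W1 i.
  by have [z xz] := connect_first (Fc x y xW yW) xy; exists [set x; z].
have Fdis i j f : f \in F i -> f \in F j -> i = j.
  (* An edge common to two trees would put two vertices into [W i :&: W j]. *)
  have [FiE FiW _ _] := FP i; have [_ FjW _ _] := FP j.
  move=> fi fj; apply/eqP; apply: contraT => /WI.
  rewrite leqNgt => /negP[]; apply: leq_trans (_ : #|f| <= _); last first.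
    by rewrite subset_leq_card // subsetI FiW ?FjW.
  have /imsetP[[u v]] := subsetP FiE f fi; rewrite inE /= => uv ->.
  by rewrite cards2; case: eqP uv => // ->; rewrite adj_irrefl.
pose c f : I + {set G} := if [pick i | f \in F i] is Some i then inl i else inr f.
have cF i f : f \in F i -> c f = inl i.
  rewrite /c => fi; case: pickP => [j fj|/(_ i)]; last by rewrite fi.
  by rewrite (Fdis i j f).
have cN f : f \notin \bigcup_i F i -> c f = inr f.
  rewrite /c => fN; case: pickP => // j fj.
  by case/negP: fN; apply/bigcupP; exists j.
have cM : mc_coloring c.
  apply/forallP => u; apply/forallP => v; apply/implyP => uv.
  have [auv|/(Wn u v uv)[i /andP[uW vW]]] := boolP (adj u v).
    apply/existsP; exists [set u; v]; rewrite edgeP //=.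
    by apply: connect1; rewrite /= auv eqxx.
  have [f fi] := F0 i; have [FE _ _ Fc] := FP i.
  apply/existsP; exists f; rewrite (subsetP FE) //=.
  apply: (connect_homo (h := id)) (Fc u v uW vW) => x y /= xy.
  by rewrite (cF i _ xy) (cF i _ fi) eqxx andbT -edges_adj (subsetP FE).
have := mc_max cM; rewrite ncolors_card => /(leq_trans _) cmax.
have FS : #|\bigcup_i F i| + #|I| <= \sum_i #|W i|.
  have <- : \sum_(i : I) 1 = #|I| by rewrite sum_nat_const muln1.
  apply: (@leq_trans (\sum_i #|F i| + \sum_(i : I) 1)).
    rewrite leq_add2r; elim/big_rec2: _ => [|i y1 y2 _ IH]; first by rewrite cards0.
    apply: leq_trans (_ : #|F i| + #|y2| <= _); last by rewrite leq_add2l.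
    by rewrite cardsU leq_subr.
  by rewrite -big_split /=; apply: leq_sum => i _; have [_ _] := FP i; rewrite addn1.
have : #|I| + #|edges G :\: \bigcup_i F i| <= mc G.
  apply: cmax.
  have -> : #|I| = #|[set (inl i : I + {set G}) | i in I]|.
    by rewrite card_imset //; move=> i j [].
  have <- : #|[set (inr f : I + {set G}) | f in edges G :\: \bigcup_i F i]|
      = #|edges G :\: \bigcup_i F i|.
    by rewrite card_imset //; move=> i j [].
  rewrite -cardsUI (_ : _ :&: _ = set0) ?cards0 ?addn0; last first.
    apply/setP => x; rewrite in_setI in_set0; apply/negbTE/negP.
    by case/andP => /imsetP[i iI ->] /imsetP[f fE].
  apply: subset_leq_card; rewrite subUset; apply/andP; split; apply/subsetP => y /imsetP[].
    move=> i _ ->; have [f fi] := F0 i; rewrite -(cF i f fi) imset_f //.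
    by have [FE _ _ _] := FP i; rewrite (subsetP FE).
  by move=> f; rewrite inE => /andP[/cN fN fE] ->; rewrite -fN imset_f.
rewrite cardsD; have : #|edges G :&: \bigcup_i F i| <= #|\bigcup_i F i|.
  by rewrite subset_leq_card ?subsetIr.
lia.
Qed.

Lemma color_classes (G : sgraph) : connected G ->
  exists P : {set {set {set G}}}, [/\ partition P (edges G), #|P| = mc G &
    forall u v, u != v -> exists2 F, F \in P & connect (erel F) u v].
Proof.
move=> /mc_attained[c cM cE]; exists (preim_partition c (edges G)); split.
- exact: preim_partitionP.
- rewrite -cE.
  (* Sending an edge to its class separates edges exactly as [c] does, so counting classes counts
     colors. *)
  pose d f := [set g in edges G | c f == c g].
  have /ncolors_recolor -> : {in edges G &, forall f g, (c f == c g) = (d f == d g)}.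
    move=> f g fE gE; apply/eqP/eqP => [fg|/setP/(_ g)].
      by apply/setP => h; rewrite !inE fg.
    by rewrite !inE gE eqxx /= => /eqP.
  by rewrite ncolors_card.
move=> u v uv.
have /existsP[f /andP[fE cuv]] := implyP (forallP (forallP cM u) v) uv.
exists [set g in edges G | c f == c g]; first exact: imset_f.
apply: (connect_homo (h := id)) cuv => x y /= /andP[xy /eqP e].
by rewrite /erel /= inE edges_adj xy e eqxx.
Qed.

(** * Components of a color class *)

Definition ecomp (G : sgraph) (F : {set {set G}}) (x : G) : {set G} :=
  [set y | connect (erel F) x y].

Lemma ecomp_refl (G : sgraph) (F : {set {set G}}) (x : G) : x \in ecomp F x.
Proof. by rewrite inE connect0. Qed.

Lemma ecomp_sym (G : sgraph) (F : {set {set G}}) (x y : G) :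
  (y \in ecomp F x) = (x \in ecomp F y).
Proof. by rewrite !inE con_sym. Qed.

Lemma ecomp_eq (G : sgraph) (F : {set {set G}}) (x y : G) :
  y \in ecomp F x -> ecomp F y = ecomp F x.
Proof.
rewrite inE => xy; apply/setP => z; rewrite !inE.
by rewrite (same_connect (@con_sym G F) xy).
Qed.

Lemma ecomp_edge (G : sgraph) (F : {set {set G}}) (x y : G) :
  [set x; y] \in F -> y \in ecomp F x.
Proof. by move=> xy; rewrite inE connect1. Qed.

Lemma card_ecomp (G : sgraph) (F : {set {set G}}) (x : G) :
  #|ecomp F x| <= #|F|.+1.
Proof.
rewrite (cardsD1 x) ecomp_refl ltnS; apply: (@reach_card G F [set x]).
  by move=> y /setD1P[_]; rewrite inE => xy; exists x; rewrite ?set11.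
by rewrite disjoint_sym disjoints1 !inE eqxx.
Qed.

(** Both components are grown at once from the two roots [x] and [y], each further vertex costing an
    edge of [F]. *)
Lemma card_ecomp2 (G : sgraph) (F : {set {set G}}) (x y : G) :
  y \notin ecomp F x -> #|ecomp F x| + #|ecomp F y| <= #|F|.+2.
Proof.
move=> xNy; rewrite (cardsD1 x (ecomp F x)) (cardsD1 y (ecomp F y)) !ecomp_refl.
rewrite !add1n addSn addnS !ltnS -cardsUI.
have -> : (ecomp F x :\ x) :&: (ecomp F y :\ y) = set0.
  apply/eqP; apply: contraNT xNy => /set0Pn[z].
  rewrite !in_setI !in_setD1 => /andP[/andP[_ zx] /andP[_ zy]].
  by rewrite -(ecomp_eq zx) ecomp_sym.
rewrite cards0 addn0; apply: (@reach_card G F [set x; y]).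
  move=> z /setUP[] /setD1P[_]; rewrite inE => ?; [exists x|exists y] => //;
  by rewrite !inE eqxx ?orbT.
have yNx : x \notin ecomp F y by rewrite ecomp_sym.
rewrite disjoint_sym; apply/pred0P => z /=; apply/negbTE.
rewrite in_set2 in_setU !in_setD1.
by apply/negP => /andP[/orP[]/eqP->]; rewrite eqxx ?(negbTE xNy) ?(negbTE yNx) /= ?andbF.
Qed.

(** The edges of [F] chosen at [x] and at [y] are distinct, since a single edge containing both
    would make them adjacent. *)
Lemma nonadj_class (G : sgraph) (F : {set {set G}}) (x y : G) :
  F \subset edges G -> x != y -> ~~ adj x y -> connect (erel F) x y -> 1 < #|F|.
Proof.
move=> FE xy nxy cxy; have [u xu] := connect_first cxy xy.
have [v yv] : exists v, erel F y v.
  by apply: (@connect_first _ _ y x); rewrite 1?con_sym 1?eq_sym.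
apply/card_gt1P; exists [set x; u], [set y; v]; split=> //.
apply: contraNneq nxy => E; have : y \in [set x; u] by rewrite E set21.
rewrite !inE eq_sym (negbTE xy) => /eqP->.
by rewrite -edges_adj (subsetP FE).
Qed.

(** * Vertex cuts and the size of a class that crosses them *)

(** Each side may be a union of several components of the graph without [S]. *)
Definition separation (G : sgraph) (A B S : {set G}) : Prop :=
  [/\ [disjoint A & B], A :|: B = ~: S, A != set0, B != set0 &
      forall a b, a \in A -> b \in B -> ~~ adj a b].

Lemma separationC (G : sgraph) (A B S : {set G}) :
  separation A B S -> separation B A S.
Proof.
case=> dAB cAB A0 B0 nAB; split=> //; rewrite 1?disjoint_sym 1?setUC //.
by move=> b a bB aA; rewrite adj_sym nAB.
Qed.

Lemma separation_card (G : sgraph) (A B S X : {set G}) : separation A B S ->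
  #|X| = #|X :&: A| + #|X :&: B| + #|X :&: S|.
Proof.
case=> dAB cAB _ _ _; rewrite -(cardsID S X) addnC; congr (_ + _).
rewrite setDE -cAB setIUr -cardsUI -setIIr (_ : A :&: B = set0).
  by rewrite setI0 cards0 addn0.
by apply/eqP; rewrite setI_eq0.
Qed.

Lemma ecomp_card (G : sgraph) (A B S : {set G}) : separation A B S ->
  forall F x, #|ecomp F x| =
    #|ecomp F x :&: A| + #|ecomp F x :&: B| + #|ecomp F x :&: S|.
Proof. by move=> sep F x; apply: separation_card sep. Qed.

(** A path from [a] to [B] leaves [A] along some edge; its far end is not in [B], so it lies in
    [S]. *)
Lemma ecomp_meets_cut (G : sgraph) (A B S : {set G}) (F : {set {set G}}) (a : G) :
  separation A B S -> F \subset edges G -> a \in A -> 0 < #|ecomp F a :&: B| ->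
  0 < #|ecomp F a :&: S|.
Proof.
move=> [dAB cAB _ _ nAB] FE aA /card_gt0P[b /setIP[ab bB]].
have := ab; rewrite inE => cab.
have [||u [v [/setIP[uA au] vN uv]]] := connect_cross (R := A :&: ecomp F a) cab.
- by rewrite inE aA ecomp_refl.
- by rewrite inE (disjointFl dAB bB).
have auv : adj u v by rewrite -edges_adj (subsetP FE).
have av : v \in ecomp F a by rewrite -(ecomp_eq au) ecomp_edge.
apply/card_gt0P; exists v; rewrite inE av /=.
apply: contraT => vS; have : v \in A :|: B by rewrite cAB inE.
case/setUP => [vA|vB]; first by rewrite inE vA av in vN.
by have := nAB u v uA vB; rewrite auv.
Qed.

Lemma card_meet_gt0 (T : finType) (X Y : {set T}) x :
  x \in X -> x \in Y -> 0 < #|X :&: Y|.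
Proof. by move=> xX xY; apply/card_gt0P; exists x; rewrite inE xX. Qed.

(** A component meeting both sides spends an extra edge on a vertex of [S]. Taking [a] out of [A]
    avoids counting the pair of [a] and [b] twice when they share a component; [F != set0] settles
    the case where both terms vanish. *)
Lemma class_bound (G : sgraph) (A B S : {set G}) (F : {set {set G}}) (a b : G) :
  separation A B S -> F \subset edges G -> F != set0 -> a \in A -> b \in B ->
  #|ecomp F a :&: B| + #|ecomp F b :&: (A :\ a)| < #|F|.
Proof.
move=> sep FE F0 aA bB; rewrite -card_gt0 in F0.
have sep' := separationC sep.
have := ecomp_meets_cut sep FE aA; have := ecomp_meets_cut sep' FE bB.
have := card_ecomp F a; have := card_ecomp F b.
rewrite !(ecomp_card sep).
have aa : 0 < #|ecomp F a :&: A| by apply: card_meet_gt0 (ecomp_refl _ _) aA.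
have bb : 0 < #|ecomp F b :&: B| by apply: card_meet_gt0 (ecomp_refl _ _) bB.
have : #|ecomp F b :&: A| = (a \in ecomp F b) + #|ecomp F b :&: (A :\ a)|.
  by rewrite (cardsD1 a) inE aA andbT setIDA.
have [ab|aNb] := boolP (b \in ecomp F a).
  by rewrite (ecomp_eq ab) ecomp_refl; lia.
have := card_ecomp2 aNb; rewrite !(ecomp_card sep) ecomp_sym (negbTE aNb); lia.
Qed.

(** Two different components each pay for their own vertex of [S]. The resulting extra edge
    contradicts the equality of the extremal case. *)
Lemma class_bound_strict (G : sgraph) (A B S : {set G}) (F : {set {set G}})
    (a b : G) :
  separation A B S -> F \subset edges G -> a \in A -> b \in B ->
  b \notin ecomp F a -> 0 < #|ecomp F a :&: B| -> 0 < #|ecomp F b :&: A| ->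
  (#|ecomp F a :&: B| + #|ecomp F b :&: A|).+1 < #|F|.
Proof.
move=> sep FE aA bB aNb; have sep' := separationC sep.
have := ecomp_meets_cut sep FE aA; have := ecomp_meets_cut sep' FE bB.
have aa : 0 < #|ecomp F a :&: A| by apply: card_meet_gt0 (ecomp_refl _ _) aA.
have bb : 0 < #|ecomp F b :&: B| by apply: card_meet_gt0 (ecomp_refl _ _) bB.
have := card_ecomp2 aNb; rewrite !(ecomp_card sep); lia.
Qed.

(* If the edges of [F] are already exhausted by a piece joining [a] alone to
   part of [B], then no other vertex of [A] is joined to [B]. *)
Lemma class_lopsided (G : sgraph) (A B S : {set G}) (F : {set {set G}})
    (a a' : G) :
  separation A B S -> F \subset edges G -> a \in A -> a' \in A -> a != a' ->
  0 < #|ecomp F a :&: B| -> #|F| <= #|ecomp F a :&: B|.+1 ->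
  #|ecomp F a' :&: B| = 0.
Proof.
move=> sep FE aA a'A aa' aB FB; have [//|a'B] := posnP #|ecomp F a' :&: B|.
have := ecomp_meets_cut sep FE aA aB; have := ecomp_meets_cut sep FE a'A a'B.
have := card_ecomp F a; rewrite !(ecomp_card sep).
have a0 : 0 < #|ecomp F a :&: A| by apply: card_meet_gt0 (ecomp_refl _ _) aA.
have a'0 : 0 < #|ecomp F a' :&: A| by apply: card_meet_gt0 (ecomp_refl _ _) a'A.
(* Either way there are too many vertices: a separate component of [a'] has at least three, one in
   each of [A], [B] and [S]; in a common component [a'] is a second vertex of [A]. *)
have [aca'|aNa'] := boolP (a' \in ecomp F a); last first.
  by have := card_ecomp2 aNa'; rewrite !(ecomp_card sep); lia.
have : 1 < #|ecomp F a :&: A|.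
  by apply/card_gt1P; exists a, a'; rewrite !in_setI ecomp_refl aA aca' a'A.
lia.
Qed.

(** * Summing over the color classes *)

Definition mc_partition (G : sgraph) (P : {set {set {set G}}}) : Prop :=
  partition P (edges G) /\
  forall u v, u != v -> exists2 F, F \in P & connect (erel F) u v.

Lemma sum_class (G : sgraph) (P : {set {set {set G}}}) :
  partition P (edges G) -> \sum_(F in P) #|F|.-1 + #|P| = #|edges G|.
Proof.
move=> Pp; rewrite (card_partition Pp) -sum1_card -big_split /=.
apply: eq_bigr => F FP; rewrite addn1 prednK // card_gt0.
by apply: contraTneq FP => ->; have /and3P[] := Pp.
Qed.

Lemma class_sub (G : sgraph) (P : {set {set {set G}}}) F :
  partition P (edges G) -> F \in P -> F \subset edges G /\ F != set0.
Proof.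
move=> Pp FP; split; last by apply: contraTneq FP => ->; have /and3P[] := Pp.
by rewrite -(cover_partition Pp); apply: (bigcup_sup F).
Qed.

Lemma cut_sum (G : sgraph) (P : {set {set {set G}}}) (A B S : {set G}) a b :
  mc_partition P -> separation A B S -> a \in A -> b \in B ->
  [/\ {in P, forall F : {set {set G}}, #|ecomp F a :&: B| + #|ecomp F b :&: (A :\ a)| <= #|F|.-1},
   \sum_(F in P) #|ecomp F a :&: B| + \sum_(F in P) #|ecomp F b :&: (A :\ a)|
     <= \sum_(F in P) #|F|.-1,
   #|B| <= \sum_(F in P) #|ecomp F a :&: B| &
   #|A|.-1 <= \sum_(F in P) #|ecomp F b :&: (A :\ a)|].
Proof.
move=> [Pp Pc] sep aA bB; have [dAB _ _ _ _] := sep.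
have le1 : {in P, forall F : {set {set G}},
    #|ecomp F a :&: B| + #|ecomp F b :&: (A :\ a)| <= #|F|.-1}.
  move=> F FP; have [FE F0] := class_sub Pp FP.
  by have := class_bound sep FE F0 aA bB; lia.
split=> //; first by rewrite -big_split /=; apply: leq_sum.
- apply: cover_leq_sum => [F _|y yB]; first exact: subsetIr.
  have [|F FP ay] := Pc a y; last by exists F; rewrite ?inE ?ay.
  by apply: contraTneq aA => ->; rewrite (disjointFl dAB yB).
have -> : #|A|.-1 = #|A :\ a| by rewrite (cardsD1 a A) aA.
apply: cover_leq_sum => [F _|x xA]; first exact: subsetIr.
have [|F FP bx] := Pc b x; last by exists F => //; rewrite in_setI xA inE bx.
apply: contraTneq bB => ->; case/setD1P: xA => _ xA.
by rewrite (disjointFr dAB xA).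
Qed.

Lemma cut_bound (G : sgraph) (P : {set {set {set G}}}) (A B S : {set G}) :
  mc_partition P -> separation A B S -> #|A| + #|B| <= (\sum_(F in P) #|F|.-1).+1.
Proof.
move=> Pm sep; have [_ _ /set0Pn[a aA] /set0Pn[b bB] _] := sep.
have A0 : 0 < #|A| by apply/card_gt0P; exists a.
have [_] := cut_sum Pm sep aA bB; lia.
Qed.

(** The upper bound on the sum leaves no slack in [cut_sum]: every class attains its bound, and the
    vertices of [B] are covered exactly once, so each is joined to [a] by a single class. *)
Lemma cut_eq (G : sgraph) (P : {set {set {set G}}}) (A B S : {set G}) a b :
  mc_partition P -> separation A B S ->
  (\sum_(F in P) #|F|.-1).+1 <= #|A| + #|B| -> a \in A -> b \in B ->
  {in P, forall F : {set {set G}}, #|F| = (#|ecomp F a :&: B| + #|ecomp F b :&: (A :\ a)|).+1} /\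
  {in P &, forall (F F' : {set {set G}}) x, x \in ecomp F a :&: B -> x \in ecomp F' a :&: B -> F = F'}.
Proof.
move=> Pm sep le aA bB; have [Pp Pc] := Pm.
have [le1 le2 leB leA] := cut_sum Pm sep aA bB; have [dAB _ _ _ _] := sep.
have A0 : 0 < #|A| by apply/card_gt0P; exists a.
split.
  have ge : \sum_(F in P) #|F|.-1 <=
      \sum_(F in P) #|ecomp F a :&: B| + \sum_(F in P) #|ecomp F b :&: (A :\ a)|.
    lia.
  rewrite -big_split /= in ge; move=> F FP; rewrite (sum_leq_eq le1 ge) //.
  by rewrite prednK // card_gt0; have [] := class_sub Pp FP.
apply: cover_eq_sum => [F _|y yB|]; first exact: subsetIr.
  have [|F FP ay] := Pc a y; last by exists F; rewrite ?inE ?ay.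
  by apply: contraTneq aA => ->; rewrite (disjointFl dAB yB).
lia.
Qed.

(** * Extremal case with at least two vertices on both sides *)

Lemma universal_cut (G : sgraph) (P : {set {set {set G}}}) (A B S : {set G}) :
  mc_partition P -> separation A B S ->
  (\sum_(F in P) #|F|.-1).+1 <= #|A| + #|B| -> 1 < #|A| -> 1 < #|B| ->
  exists2 s, s \in S & forall x y, x \in S :\ s -> x != y -> adj x y.
Proof.
move=> Pm sep le A1 B1; have [Pp Pc] := Pm; have sep' := separationC sep.
(* A nontrivial class joins all of [A] to all of [B]. Otherwise [class_bound_strict] forces one of
   the two terms to vanish; by [class_lopsided], replacing [a] or [b] by another vertex of its side
   makes both vanish, so the equality gives [#|F| = 1]. *)
have full F a b : F \in P -> 1 < #|F| -> a \in A -> b \in B -> b \in ecomp F a.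
  move=> FP F1 aA bB; apply: contraT => aNb; have [FE _] := class_sub Pp FP.
  have eqF a' b' : a' \in A -> b' \in B ->
      #|F| = (#|ecomp F a' :&: B| + #|ecomp F b' :&: (A :\ a')|).+1.
    by move=> a'A b'B; have [-> //] := cut_eq Pm sep le a'A b'B.
  have QE : ecomp F b :&: (A :\ a) = ecomp F b :&: A.
    apply/setP => x; rewrite !in_setI in_setD1; case: eqP => // ->.
    by rewrite ecomp_sym (negbTE aNb).
  have E := eqF a b aA bB; rewrite QE in E.
  have st := class_bound_strict sep FE aA bB aNb.
  have [a' a'A aa'] : exists2 a', a' \in A & a != a'.
    have : 0 < #|A :\ a| by rewrite (cardsD1 a) aA in A1.
    by case/card_gt0P => a' /setD1P[? ?]; exists a'; rewrite 1?eq_sym.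
  have [b' b'B bb'] : exists2 b', b' \in B & b != b'.
    have : 0 < #|B :\ b| by rewrite (cardsD1 b) bB in B1.
    by case/card_gt0P => b' /setD1P[? ?]; exists b'; rewrite 1?eq_sym.
  have QA c x : #|ecomp F c :&: (A :\ x)| <= #|ecomp F c :&: A|.
    by rewrite subset_leq_card // setIS // subD1set.
  have [P0|P0] := posnP #|ecomp F a :&: B|.
    rewrite P0 add0n in E; have Q0 : 0 < #|ecomp F b :&: A| by rewrite E in F1.
    have := class_lopsided sep' FE bB b'B bb' Q0; rewrite E leqnn => /(_ isT) b'A.
    have := QA b' a; rewrite b'A leqn0 => /eqP b'Aa.
    by rewrite (eqF a b' aA b'B) P0 b'Aa in F1.
  have [Q0|Q0] := posnP #|ecomp F b :&: A|; last first.
    by have := st P0 Q0; rewrite E ltnn.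
  rewrite Q0 addn0 in E.
  have := class_lopsided sep FE aA a'A aa' P0; rewrite E leqnn => /(_ isT) a'B.
  have := QA b a'; rewrite Q0 leqn0 => /eqP bAa'.
  by rewrite (eqF a' b a'A bB) a'B bAa' in F1.
have [_ _ /set0Pn[a aA] /set0Pn[b bB] _] := sep.
(* If all classes were single edges, the sum would be zero and [cut_bound] would give
   [#|A| + #|B| <= 1]. *)
have [F FP F1] : exists2 F, F \in P & 1 < #|F|.
  apply/exists_inP; apply: contraT => /exists_inPn nF; move: (cut_bound Pm sep).
  rewrite big1 => [|F FP]; first by lia.
  by have := nF F FP; lia.
have [eqF unF] := cut_eq Pm sep le aA bB; have [FE _] := class_sub Pp FP.
have ab := full F a b FP F1 aA bB.
have FAB : #|F| = #|A| + #|B|.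
  rewrite (eqF F FP) (_ : ecomp F a :&: B = B); last first.
    by apply/setIidPr/subsetP => y yB; apply: full.
  rewrite (_ : ecomp F b :&: (A :\ a) = A :\ a).
    by rewrite (cardsD1 a A) aA; lia.
  by apply/setIidPr/subsetP => x /setD1P[_ xA]; rewrite ecomp_sym full.
have compA : ecomp F a :&: A = A.
  apply/setIidPr/subsetP => x xA; rewrite -(ecomp_eq ab) ecomp_sym; exact: full.
have compB : ecomp F a :&: B = B.
  by apply/setIidPr/subsetP => y yB; apply: full.
have S0 : 0 < #|ecomp F a :&: S| by apply: ecomp_meets_cut sep FE aA _; rewrite compB ltnW.
have [s /setIP[as_ sS]] := card_gt0P S0.
exists s => // x y /setD1P[xs xS] xy; apply: contraT => nxy.
have [F' F'P cxy] := Pc x y xy; have [F'E _] := class_sub Pp F'P.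
have F'1 := nonadj_class F'E xy nxy cxy.
(* Both classes are nontrivial, so both join [a] to [b], which only one class does. *)
have FF' : F' = F by apply: (unF _ _ F'P FP b); rewrite inE bB full.
rewrite {}FF' {F' F'P F'E F'1} in cxy.
have := card_ecomp F a; rewrite (ecomp_card sep) compA compB.
(* The component of [a] consists of [A], [B] and [s], and this already uses all the edges of [F]:
   there is room neither for a second vertex of [S] nor for another component with two vertices. *)
have [ax|aNx] := boolP (x \in ecomp F a).
  have : 1 < #|ecomp F a :&: S|.
    by apply/card_gt1P; exists s, x; rewrite !in_setI as_ sS ax xS eq_sym.
  by rewrite FAB; clear; lia.
have := card_ecomp2 aNx; rewrite (ecomp_card sep _ a) compA compB.
have : 1 < #|ecomp F x|.
  by apply/card_gt1P; exists x, y; rewrite ecomp_refl inE cxy.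
by rewrite FAB; move: S0; clear; lia.
Qed.

(** The complete factor is [S :\ s] and [H] is induced on the other vertices. It is connected
    because only [k - 1] vertices are deleted, and [s] is a cut-vertex because it separates [A] from
    [B] there. *)
Lemma universal_cut_in_A (G : sgraph) (k : nat) (A B S : {set G}) (s : G) :
  kconnected k G -> separation A B S -> #|S| = k -> s \in S ->
  (forall x y, x \in S :\ s -> x != y -> adj x y) -> in_A #|G| k G.
Proof.
move=> /andP[kG /forallP kc] [dAB cAB /set0Pn[a aA] /set0Pn[b bB] nAB] Sk sS univ.
pose C := ~: (S :\ s).
pose hadj : rel {x | x \in C} := fun x y => adj (val x) (val y).
have hsym : symmetric hadj by move=> x y; rewrite /hadj adj_sym.
have hirr : irreflexive hadj by move=> x; rewrite /hadj adj_irrefl.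
pose H := SGraph hsym hirr.
have SC : #|S :\ s| = k - 1 by rewrite -Sk (cardsD1 s S) sS; lia.
have k0 : 0 < k by rewrite -Sk; apply/card_gt0P; exists s.
have cH : #|H| = #|G| - k + 1.
  by rewrite card_sig -/C (eq_card (B := C)) // cardsCs setCK SC; lia.
have sC : s \in C by rewrite !inE eqxx.
have ABC x : x \notin S -> x \in C by rewrite !inE => /negbTE->; rewrite andbF.
have AS x : x \in A -> x \notin S by rewrite -in_setC -cAB inE => ->.
have BS x : x \in B -> x \notin S by rewrite -in_setC -cAB inE orbC => ->.
have Hc : connected H.
  have /implyP/(_ _)/forall_inP Cc := kc (S :\ s); rewrite SC in Cc.
  have {}Cc := Cc ltac:(lia).
  (* Vertices outside [C] go to [s] by default; the paths carried over by [h] stay inside [C]. *)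
  pose h x : H := insubd (Sub s sC) x.
  have hK (x : H) : h (val x) = x by rewrite /h valKd.
  apply/forall_inP => x _; apply/forall_inP => y _.
  have /forall_inP/(_ _ (valP y)) := Cc _ (valP x).
  move=> /(connect_homo (h := h)) cxy; rewrite -[x]hK -[y]hK; apply: cxy => u v.
  move=> /and3P[uC vC uv]; rewrite /= !in_setT /= /hadj.
  by rewrite /h !val_insubd uC vC.
exists H; split=> //.
  exists (Sub s sC); rewrite /cut_vertex Hc /=; apply/negP => /forall_inP Hs.
  have aC := ABC a (AS a aA); have bC := ABC b (BS b bB).
  have ns x (xC : x \in C) : x \notin S -> (Sub x xC : H) \in ~: [set Sub s sC].
    by rewrite !inE -val_eqE /=; apply: contraNneq => ->.
  have /forall_inP/(_ _ (ns b bC (BS b bB))) := Hs _ (ns a aC (AS a aA)).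
  (* A path of [H] avoiding [s] would leave [A] at a vertex outside [S], hence enter [B]
     directly. *)
  move=> /(connect_cross (R := [set x : H | val x \in A])).
  rewrite !inE /= aA (disjointFl dAB bB) => /(_ isT isT)[u [v []]].
  rewrite !inE => uA vA /and3P[_ vs uv].
  have vS : val v \notin S.
    by have := valP v; rewrite !inE negb_and negbK -val_eqE /= in vs * => /orP[/eqP vE|//];
      rewrite vE eqxx in vs.
  have : val v \in A :|: B by rewrite cAB inE.
  by rewrite inE (negbTE vA) => vB; have := nAB _ _ uA vB; rewrite [adj _ _]uv.
pose g (z : join (complete (k - 1)) H) : G :=
  match z with inl i => enum_val (cast_ord (esym SC) i) | inr x => val x end.
have gS i : g (inl i) \in S :\ s by exact: enum_valP.
have gC x : g (inr x) \notin S :\ s by have := valP x; rewrite in_setC.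
have g_inj : injective g.
  move=> [i|x] [j|y] E.
  - by move/enum_val_inj: E => /cast_ord_inj ->.
  - by have := gS i; rewrite E (negbTE (gC y)).
  - by have := gS j; rewrite -E (negbTE (gC x)).
  - by rewrite (val_inj E).
have gadj x y : adj (g x) (g y) = adj x y.
  have [->|xy] := eqVneq x y; first by rewrite !adj_irrefl.
  have gxy : g x != g y by rewrite (inj_eq g_inj).
  case: x y xy gxy => [i|x] [j|y] // xy gxy.
  - have ij : i != j by apply: contra xy => /eqP->.
    by rewrite univ //; apply/esym.
  - by rewrite univ.
  - by rewrite adj_sym univ // eq_sym.
have [f gK fK] : bijective g.
  apply: inj_card_bij => //; rewrite card_sum card_ord cH; lia.
exists f; first by exists g.
by move=> x y; rewrite -gadj !fK.
Qed.

(** * Extremal case with a single vertex on one side *)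

Lemma connected_in_root (G : sgraph) (U : {set G}) (r : G) :
  (forall x, x \in U ->
     connect [rel a b | [&& a \in U, b \in U & adj a b]] r x) ->
  connected_in U.
Proof.
move=> Ur; apply/forall_inP => x xU; apply/forall_inP => y yU.
apply: connect_trans (Ur y yU); rewrite sym_connect_sym; first exact: Ur.
by move=> a b /=; rewrite adj_sym andbCA.
Qed.

(** Each part is indexed by its unique neighbor of [v]; enumerating [S] turns this into a family
    over ['I_k]. *)
Lemma perfectly_connected_family (k : nat) (G : sgraph) (v : G) (S : {set G})
    (W : G -> {set G}) :
  #|S| = k -> {in S, forall s, s \in W s} ->
  {in S &, forall s t x, x \in W s -> x \in W t -> s = t} ->
  (forall x, x != v -> exists2 s, s \in S & x \in W s) ->
  {in S, forall s, v \notin W s} ->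
  {in S, forall s, connected_in (W s)} ->
  {in S &, forall s t x y, s != t -> x \in W s -> y \in W t -> adj x y} ->
  {in S, forall s u, u \in W s -> adj v u = (u == s)} ->
  perfectly_connected k G.
Proof.
move=> Sk Wr Wd Wc vW Wconn Wm Wv.
pose e i := enum_val (cast_ord (esym Sk) i).
have eS i : e i \in S by exact: enum_valP.
have e_inj : injective e by move=> i j /enum_val_inj/cast_ord_inj.
exists v, (fun i => W (e i)); split.
- split=> [i|i j ij]; first by apply/set0Pn; exists (e i); apply: Wr.
  apply/pred0P => x /=; apply: contraNF ij => /andP[xi xj].
  by apply/eqP/e_inj/(Wd _ _ (eS i) (eS j) x).
- apply/setP => x; rewrite !inE; apply/bigcupP/idP => [[i _ xi]|/Wc[s sS xs]].
    by apply: contraTneq xi => ->; apply: vW.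
  exists (cast_ord Sk (enum_rank_in sS s)) => //.
  by rewrite /e cast_ordK enum_rankK_in.
- by move=> i; apply: Wconn.
- by move=> i j ij x y; apply: Wm => //; rewrite (inj_eq e_inj).
move=> i; apply/eqP/cards1P; exists (e i); apply/setP => u; rewrite !inE.
apply/andP/eqP => [[uW]|->]; first by rewrite (Wv _ (eS i) u uW) => /eqP.
by rewrite Wr // (Wv _ (eS i)) ?Wr ?eqxx.
Qed.

Lemma star_perfectly_connected (k : nat) (G : sgraph) (P : {set {set {set G}}})
    (A S : {set G}) (b : G) :
  mc_partition P -> separation A [set b] S ->
  (\sum_(F in P) #|F|.-1).+1 <= #|A| + 1 -> {in S, forall s, adj b s} ->
  #|S| = k -> perfectly_connected k G.
Proof.
move=> [Pp Pc] sep le bS Sk; have sep' := separationC sep.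
have [dAB cAB _ _ nAB] := sep.
have bA : b \notin A by rewrite (disjointFl dAB) ?set11.
have bNS : b \notin S by rewrite -in_setC -cAB !inE eqxx orbT.
have AS x : x \in A -> x \notin S by move=> xA; rewrite -in_setC -cAB inE xA.
have ASb x : x != b -> x \notin S -> x \in A.
  by rewrite -in_setC -cAB !inE => /negbTE->; rewrite orbF.
have bB F : #|ecomp F b :&: [set b]| = 1.
  by rewrite (setIidPr _) ?cards1 // sub1set ecomp_refl.
have FE F : F \in P -> F \subset edges G by case/(class_sub Pp).
have le1 : {in P, forall F : {set {set G}}, #|ecomp F b :&: A| <= #|F|.-1}.
  move=> F FP; have [_] := class_sub Pp FP; rewrite -card_gt0.
  have := ecomp_meets_cut sep' (FE F FP) (set11 b).
  by have := card_ecomp F b; rewrite (ecomp_card sep) bB; clear; lia.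
have cover : {in A, forall x, exists2 F, F \in P & x \in ecomp F b :&: A}.
  move=> x xA; have [|F FP bx] := Pc b x; last by exists F; rewrite ?inE ?bx.
  by apply: contraNneq bA => ->.
have sub : {in P, forall F : {set {set G}}, ecomp F b :&: A \subset A}.
  by move=> F _; apply: subsetIr.
have leA := cover_leq_sum sub cover; rewrite addn1 ltnS in le.
(* From [b], each class reaches exactly [#|F|.-1] vertices of [A], which leaves room for at most one
   vertex of [S]. *)
have eqF := sum_leq_eq le1 (leq_trans le leA).
have unF : {in P &, forall (F F' : {set {set G}}) x,
    x \in ecomp F b :&: A -> x \in ecomp F' b :&: A -> F = F'}.
  by apply: cover_eq_sum cover _ => //; apply: leq_trans le; apply: leq_sum.
clear le leA; have F0 F : F \in P -> 0 < #|F|.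
  by move=> /(class_sub Pp)[_]; rewrite card_gt0.
have cS F : F \in P -> #|ecomp F b :&: S| <= 1.
  move=> FP; have := card_ecomp F b; rewrite (ecomp_card sep) bB eqF //.
  by have := F0 F FP; clear; lia.
(* In a nontrivial class the component of [b] already has [#|F| + 1] vertices, so all other
   components are single vertices. *)
have big F x y : F \in P -> 1 < #|F| -> x != y -> y \in ecomp F x ->
    x \in ecomp F b.
  move=> FP F1 xy xcy; apply: contraT => bNx; have := card_ecomp2 bNx.
  have : 1 < #|ecomp F x| by apply/card_gt1P; exists x, y; rewrite ecomp_refl xcy.
  have := ecomp_meets_cut sep' (FE F FP) (set11 b).
  by rewrite (ecomp_card sep F b) bB (eqF F FP); move: F1; clear; lia.
pose cl s := pblock P [set b; s].
have clP s : s \in S -> cl s \in P.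
  by move=> sS; rewrite pblock_mem // (cover_partition Pp) edges_adj bS.
have clb s : s \in S -> s \in ecomp (cl s) b.
  by move=> sS; rewrite ecomp_edge // mem_pblock (cover_partition Pp) edges_adj bS.
have clS s t : s \in S -> t \in S -> t \in ecomp (cl s) b -> s = t.
  move=> sS tS bt; apply: contraTeq (cS _ (clP s sS)) => st; rewrite -ltnNge.
  by apply/card_gt1P; exists s, t; rewrite !in_setI clb // bt sS.
(* As [b] has no neighbor in [A], a path of [F] from [b] starts with an edge to some [s] in [S], and
   [F] is the class of that edge. *)
have cl_first F x : F \in P -> x != b -> x \in ecomp F b ->
    exists2 s, s \in S & cl s = F.
  move=> FP xb; rewrite inE => bx.
  have [|s bs] := connect_first bx; first by rewrite eq_sym.
  exists s; last first.
    by apply: def_pblock => //; have /and3P[] := Pp.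
  have abs : adj b s by rewrite -edges_adj (subsetP (FE F FP)).
  have sb : s != b by apply: contraTneq abs => ->; rewrite adj_irrefl.
  apply: contraT => /(ASb s sb) sA.
  by have := nAB s b sA (set11 b); rewrite adj_sym abs.
(* The class of the edge [bs] is a tree through [b] in which [b] is a leaf
   attached to [s]; removing [b] leaves the part [W s]. *)
pose W s := s |: (ecomp (cl s) b :&: A).
have bW s : s \in S -> b \notin W s.
  move=> sS; rewrite in_setU1 in_setI (negbTE bA) andbF orbF.
  by apply: contraNneq bNS => ->.
have compW s : s \in S -> ecomp (cl s) b = b |: W s.
  move=> sS; apply/setP => x; rewrite !in_setU !in_set1 in_setI.
  have [->|xb] := eqVneq x b; first by rewrite ecomp_refl.
  have [->|xs] := eqVneq x s; first by rewrite clb.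
  have [xS|/(ASb x xb)->] := boolP (x \in S); last by rewrite andbT.
  rewrite (negbTE (contraL (AS x) xS)) andbF /=.
  by apply: contraNF xs => /(clS s x sS xS)->.
have Wcl F x : F \in P -> x != b -> x \in ecomp F b ->
    exists s, [/\ s \in S, cl s = F & x \in W s].
  move=> FP xb bx; have [s sS sF] := cl_first F x FP xb bx; exists s; split=> //.
  by move: bx; rewrite -sF compW // in_setU1 (negbTE xb).
have Wd : {in S &, forall s t x, x \in W s -> x \in W t -> s = t}.
  move=> s t sS tS x /setU1P[->|xs] /setU1P[xt|xt] //.
  - by case/setIP: xt => _ /AS; rewrite sS.
  - by case/setIP: xs => _ /AS; rewrite xt tS.
  - apply: (clS s t sS tS); rewrite (unF _ _ (clP s sS) (clP t tS) x xs xt).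
    exact: clb.
apply: (perfectly_connected_family (v := b) (W := W) Sk) => //.
- by move=> s _; rewrite setU11.
- move=> x xb; have [xS|/(ASb x xb)xA] := boolP (x \in S).
    by exists x => //; rewrite setU11.
  have [F FP /setIP[bx _]] := cover x xA.
  by have [s [sS _ xs]] := Wcl F x FP xb bx; exists s.
- move=> s sS; apply: (@connected_in_root _ _ s) => x xW.
  set e := [rel u v | _]; apply: contraT => sNx.
  have sx : connect (erel (cl s)) s x.
    have : x \in ecomp (cl s) s by rewrite (ecomp_eq (clb s sS)) compW // in_setU xW orbT.
    by rewrite inE.
  (* Here [R] holds [b] and what [s] reaches inside [W s]. An edge of the class leaving [R] must go
     to [W s]; if it started at [b] it could only end in [s], which is already in [R]. *)
  have [||u [w [uR wR uw]]] := connect_cross (R := b |: [set y in W s | connect e s y]) sx.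
  + by rewrite !inE eqxx connect0 orbT.
  + rewrite !inE (negbTE sNx) andbF orbF.
    by apply: contraTneq xW => ->; apply: bW.
  have wc : w \in ecomp (cl s) b.
    have uc : u \in ecomp (cl s) b.
      case/setU1P: (uR) => [->|]; first exact: ecomp_refl.
      by rewrite in_set compW // => /andP[uW _]; rewrite in_setU uW orbT.
    by rewrite -(ecomp_eq uc) ecomp_edge.
  have auw : adj u w by rewrite -edges_adj (subsetP (FE _ (clP s sS))).
  have wW : w \in W s.
    by move: wc; rewrite compW // in_setU1 => /orP[/eqP wb|//]; rewrite wb setU11 in wR.
  case/negP: wR; rewrite in_setU1 in_set wW /=; apply/orP; right.
  case/setU1P: uR => [ub|]; last first.
    rewrite in_set => /andP[uW /connect_trans-> //].
    by apply: connect1; rewrite /e /= uW wW.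
  case/setU1P: wW => [->|/setIP[_ wA]]; first exact: connect0.
  by have := nAB w b wA (set11 b); rewrite adj_sym -ub auw.
(* Nonadjacent [x] and [y] are joined by a nontrivial class, hence lie in its component of [b], and
   so in one common part. *)
- move=> s t sS tS x y st xs yt; apply: contraT => nxy.
  have xy : x != y by apply: contraNneq st => xy; rewrite (Wd s t sS tS x) // xy.
  have [F FP cxy] := Pc x y xy.
  have F1 := nonadj_class (FE F FP) xy nxy cxy.
  have xb : x != b by apply: contraTneq xs => ->; apply: bW.
  have yb : y != b by apply: contraTneq yt => ->; apply: bW.
  have bx : x \in ecomp F b by apply: big FP F1 xy _; rewrite inE.
  have by_ : y \in ecomp F b by rewrite -(ecomp_eq bx) inE.
  have [r [rS rF xr]] := Wcl F x FP xb bx.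
  have yr : y \in W r.
    by move: by_; rewrite -rF compW // in_setU1 (negbTE yb).
  by rewrite (Wd s r sS rS x xs xr) (Wd t r tS rS y yt yr) eqxx in st.
move=> s sS u /setU1P[->|/setIP[_ uA]]; first by rewrite bS // eqxx.
have us : u != s by apply: contraTneq uA => ->; apply: contraL sS; apply: AS.
by rewrite (negbTE us); apply/negbTE; rewrite adj_sym nAB ?set11.
Qed.

(** * Minimum cuts and complete graphs *)

(** Deleting [S :\ s] removes only [k - 1] vertices, so [b] keeps a neighbor, which can only be
    [s]. *)
Lemma kconnected_deg (G : sgraph) (k : nat) (A S : {set G}) (b : G) :
  kconnected k G -> separation A [set b] S -> #|S| = k ->
  {in S, forall s, adj b s}.
Proof.
move=> /andP[_ /forallP kc] [dAB cAB /set0Pn[a aA] _ nAB] Sk s sS.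
have /implyP/(_ _)/forall_inP Cc := kc (S :\ s).
have {}Cc := Cc ltac:(by rewrite -Sk (cardsD1 s S) sS).
have NS x : x \in A :|: [set b] -> x \in ~: (S :\ s).
  by rewrite cAB !inE => /negbTE->; rewrite andbF.
have bC : b \in ~: (S :\ s) by apply: NS; rewrite !inE eqxx orbT.
have aC : a \in ~: (S :\ s) by apply: NS; rewrite inE aA.
have /forall_inP/(_ a aC)/connect_first := Cc b bC.
have ba : b != a by apply: contraTneq aA => <-; rewrite (disjointFl dAB) ?set11.
case=> // x /and3P[_ xC bx]; suff <- : x = s by [].
apply/eqP; apply: contraT => xs; move: xC; rewrite !inE xs /= => xS.
have : x \in A :|: [set b] by rewrite cAB inE.
case/setUP => [xA|/set1P xb]; last by rewrite xb adj_irrefl in bx.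
by have := nAB x b xA (set11 b); rewrite adj_sym bx.
Qed.

(** The first alternative is the failure of the size bound. Otherwise a disconnecting set of at most
    [k] vertices has exactly [k]; one side is the component of a vertex, the other everything
    else. *)
Lemma kconnected_cut (G : sgraph) (k : nat) :
  kconnected k G -> ~~ kconnected k.+1 G ->
  #|G| = k.+1 \/ exists (A B S : {set G}), separation A B S /\ #|S| = k.
Proof.
move=> /andP[kG /forallP kc]; rewrite negb_and -leqNgt => /orP[Gk|].
  by left; apply/eqP; rewrite eqn_leq Gk.
rewrite negb_forall => /existsP[S]; rewrite negb_imply ltnS => /andP[Sk Sc].
right; have {}Sk : #|S| = k.
  apply/eqP; rewrite eqn_leq Sk leqNgt; apply: contra Sc => Sk'.
  exact: (implyP (kc S)).
move: Sc; rewrite negb_forall => /existsP[x]; rewrite negb_imply => /andP[xS].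
rewrite negb_forall => /existsP[y]; rewrite negb_imply => /andP[yS].
set e := [rel a b | _] => xNy.
exists [set z in ~: S | connect e x z], [set z in ~: S | ~~ connect e x z], S.
split=> //; split.
- by apply/pred0P => z /=; rewrite !inE; case: connect; rewrite ?andbF.
- by apply/setP => z; rewrite !inE; case: connect; rewrite ?andbF ?andbT ?orbF.
- by apply/set0Pn; exists x; rewrite inE xS connect0.
- by apply/set0Pn; exists y; rewrite inE yS xNy.
move=> a b; rewrite inE => /andP[aS xa]; rewrite inE => /andP[bS].
apply: contra => ab; apply: connect_trans xa (connect1 _).
by rewrite /e /= aS bS.
Qed.

Lemma complete_perfectly_connected (G : sgraph) (k : nat) :
  kconnected k G -> #|G| = k.+1 -> perfectly_connected k G.
Proof.
move=> /andP[_ /forallP kc] Gk.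
have univ (x y : G) : x != y -> adj x y.
  (* Deleting all vertices but [x] and [y] removes [k - 1] of them, so what remains is connected and
     [x], [y] are adjacent. *)
  move=> xy; have /implyP/(_ _)/forall_inP Cc := kc (~: [set x; y]).
  have C2 : #|~: [set x; y]| < k.
    by have := cardsC [set x; y]; rewrite cards2 xy Gk /=; lia.
  rewrite setCK in Cc; have /forall_inP/(_ y (set22 _ _)) := Cc C2 x (set21 _ _).
  move=> /connect_first/(_ xy)[z /and3P[_ /set2P[]-> //]].
  by rewrite adj_irrefl.
have /card_gt0P[v _] : 0 < #|G| by rewrite Gk.
apply: (perfectly_connected_family (v := v) (S := ~: [set v]) (W := fun s => [set s])).
- by have := cardsC1 v; rewrite Gk.
- by move=> s _; rewrite set11.
- by move=> s t _ _ x /set1P-> /set1P->.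
- by move=> x xv; exists x; rewrite ?inE.
- by move=> s; rewrite !inE eq_sym.
- move=> s _; apply: (@connected_in_root _ _ s) => x /set1P->; exact: connect0.
- by move=> s t _ _ x y st /set1P-> /set1P->; apply: univ.
by move=> s; rewrite !inE => sv u /set1P->; rewrite univ ?eqxx // eq_sym.
Qed.

(** * Both families attain the bound *)

(** Nonadjacent pairs all lie in the copy [U] of [H], so [mc_lower] applies to the one set [U], of
    size [#|G| - k + 1]. *)
Lemma in_A_mc (G : sgraph) (k : nat) : k < #|G| -> in_A #|G| k G ->
  #|edges G| + k < mc G + #|G|.
Proof.
move=> kG [H [Hc cH _ [f f_bij fadj]]].
pose U := [set x | if f x is inr _ then true else false].
have [g fK gK] := f_bij.
have UE : U = [set g (inr h) | h : H].
  apply/setP => x; rewrite inE; apply/idP/imsetP => [|[h _ ->]].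
    by case E: (f x) => [//|h] _; exists h; rewrite // -E fK.
  by rewrite gK.
have cU : #|U| = #|H|.
  by rewrite UE card_imset // => h h' /(can_inj gK) [].
have gU h : g (inr h) \in U by rewrite UE imset_f.
have Uc : connected_in U.
  apply/forall_inP => x; rewrite {1}UE => /imsetP[h _ ->].
  apply/forall_inP => y; rewrite {1}UE => /imsetP[h' _ ->].
  have /forall_inP/(_ h (in_setT h))/forall_inP/(_ h' (in_setT h')) := Hc.
  apply: (connect_homo (h := fun z => g (inr z))) => a b /and3P[_ _ ab].
  by rewrite /= !gU -fadj !gK.
have U1 : 1 < #|U| by rewrite cU cH; move: kG; clear; lia.
have Un x y : x != y -> ~~ adj x y -> exists i : unit, (x \in U) && (y \in U).
  move=> xy nxy; exists tt; rewrite !inE.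
  have fxy : f x != f y by rewrite (inj_eq (bij_inj f_bij)).
  rewrite -fadj in nxy.
  case: (f x) (f y) fxy nxy => [i|h] [j|h'] //= ij /negP[].
  by apply: contra ij => /eqP->.
have := @mc_lower G unit (fun=> U) (fun=> Uc) (fun=> U1) _ Un.
rewrite sum_nat_const card_unit mul1n cU cH => /(_ ltac:(by case=> [[]])).
by move: kG; clear; lia.
Qed.

(** Here [mc_lower] is applied to the sets [v |: V i], which meet pairwise only in [v] and have
    sizes adding up to [#|G| - 1 + k]. *)
Lemma perfectly_connected_mc (G : sgraph) (k : nat) :
  perfectly_connected k G -> #|edges G| + k < mc G + #|G|.
Proof.
move=> [v [V [[V0 Vd] Vc Vconn Vm Vv]]].
have vV i : v \notin V i.
  have : v \notin \bigcup_i V i by rewrite Vc !inE eqxx.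
  by apply: contra => vi; apply/bigcupP; exists i.
have sV : (\sum_i #|V i|).+1 = #|G|.
  have <- : #|~: [set v]|.+1 = #|G| by rewrite cardsC1 prednK //; apply/card_gt0P; exists v.
  have := partition_disjoint_bigcup addn (fun=> 1) Vd.
  rewrite sum1_card Vc => ->.
  by congr _.+1; apply: eq_bigr => i _; rewrite sum1_card.
have W1 i : connected_in (v |: V i).
  have /eqP/cards1P[u uE] := Vv i.
  have : u \in [set u in V i | adj v u] by rewrite uE set11.
  rewrite inE => /andP[uV vu]; apply: (@connected_in_root _ _ v) => x.
  case/setU1P => [->|xV]; first exact: connect0.
  apply: (@connect_trans _ _ u).
    by apply: connect1; rewrite /= setU11 in_setU uV orbT.
  have /forall_inP/(_ u uV)/forall_inP/(_ x xV) := Vconn i.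
  apply: (connect_homo (h := id)) => a b /and3P[aV bV ab].
  by rewrite /= !in_setU aV bV ab !orbT.
have W2 i : 1 < #|v |: V i|.
  by rewrite cardsU1 vV ltnS card_gt0.
have W3 i j : i != j -> #|(v |: V i) :&: (v |: V j)| <= 1.
  move=> ij; rewrite -(cards1 v) subset_leq_card //; apply/subsetP => x.
  rewrite in_setI !in_setU1 in_set1 => /andP[/orP[//|xi] /orP[//|xj]].
  by rewrite (disjointFr (Vd i j ij) xi) in xj.
have W4 x y : x != y -> ~~ adj x y -> exists i, (x \in v |: V i) && (y \in v |: V i).
  have Vx z : z != v -> exists i, z \in V i.
    move=> zv; have : z \in \bigcup_i V i by rewrite Vc !inE.
    by case/bigcupP => i _ zi; exists i.
  move=> xy nxy; have [xv|/Vx[i xi]] := eqVneq x v.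
    have [|i yi] := Vx y; first by rewrite -xv eq_sym.
    by exists i; rewrite xv setU11 in_setU yi orbT.
  have [yv|/Vx[j yj]] := eqVneq y v.
    by exists i; rewrite yv setU11 in_setU xi orbT.
  have [ij|ij] := eqVneq i j.
    by exists i; rewrite !in_setU xi ij yj !orbT.
  by rewrite (Vm i j ij x y xi yj) in nxy.
have sW : \sum_i #|v |: V i| = \sum_i #|V i| + k.
  rewrite -[X in _ + X]card_ord -sum1_card -big_split /=.
  by apply: eq_bigr => i _; rewrite cardsU1 vV addnC.
by have := mc_lower W1 W2 W3 W4; rewrite sW card_ord -sV; clear; lia.
Qed.

(** * The upper bound and the characterization of equality *)

Lemma separation_order (G : sgraph) (A B S : {set G}) :
  separation A B S -> #|G| = #|A| + #|B| + #|S|.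
Proof.
by move=> sep; rewrite -cardsT (separation_card setT sep) !setTI.
Qed.

Lemma mc_upper (G : sgraph) (k : nat) : connected G ->
  kconnected k G -> ~~ kconnected k.+1 G ->
  mc G + #|G| <= #|edges G| + k.+1.
Proof.
move=> Gc kG nkG; have [P [Pp <- Pc]] := color_classes Gc.
have := sum_class Pp; have [->|[A [B [S [sep Sk]]]]] := kconnected_cut kG nkG.
  by clear; lia.
have := cut_bound (conj Pp Pc) sep; rewrite (separation_order sep) Sk; clear; lia.
Qed.

Lemma mc_extremal (G : sgraph) (k : nat) : connected G ->
  kconnected k G -> ~~ kconnected k.+1 G ->
  #|edges G| + k.+1 <= mc G + #|G| -> in_A #|G| k G \/ perfectly_connected k G.
Proof.
move=> Gc kG nkG; have [P [Pp <- Pc]] := color_classes Gc; have Pm := conj Pp Pc.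
have [Gk _|[A [B [S [sep Sk]]]]] := kconnected_cut kG nkG.
  by right; apply: complete_perfectly_connected.
move=> le.
have {}le : (\sum_(F in P) #|F|.-1).+1 <= #|A| + #|B|.
  by move: le (sum_class Pp); rewrite (separation_order sep) Sk; clear; lia.
have sep' := separationC sep; have [_ _ A0 B0 _] := sep.
have [B1|] := leqP #|B| 1.
  have /cards1P[b Bb] : #|B| == 1 by rewrite eqn_leq B1 card_gt0.
  rewrite {}Bb cards1 in sep le; right.
  exact: star_perfectly_connected Pm sep le (kconnected_deg kG sep Sk) Sk.
have [A1 _|A1 B1] := leqP #|A| 1.
  have /cards1P[a Aa] : #|A| == 1 by rewrite eqn_leq A1 card_gt0.
  rewrite {}Aa cards1 addnC in sep' le; right.
  exact: star_perfectly_connected Pm sep' le (kconnected_deg kG sep' Sk) Sk.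
have [s sS univ] := universal_cut Pm sep le A1 B1; left.
exact: universal_cut_in_A kG sep Sk sS univ.
Qed.

Theorem theorem2p1 (k n m : nat) (G : sgraph) (hk : 2 <= k)
    (hn : #|G| = n) (hm : #|edges G| = m)
    (hconn : kconnected k G) (hnconn : ~~ kconnected k.+1 G) :
  ((mc G)%:Z = m%:Z - n%:Z + k%:Z + 1)%R <->
    in_A n k G \/ perfectly_connected k G.
Proof.
(* Deleting the empty set, which is allowed as [0 < k], shows that [G] is connected. *)
have /andP[kG /forallP/(_ set0)/implyP Gc] := hconn.
rewrite cards0 setC0 in Gc; have {}Gc := Gc (ltnW hk).
(* Given this upper bound, the equality amounts to the reverse inequality. *)
have up := mc_upper Gc hconn hnconn; subst n m; split.
  by move=> mcE; apply: (mc_extremal Gc hconn hnconn); move: mcE; clear; lia.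
case=> [/(in_A_mc kG)|/perfectly_connected_mc]; move: up; clear; lia.
Qed.
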